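(* Let $\Delta\subset\mathbb{R}^n$ be a smooth lattice polytope with $\Delta\cap\mathbb{Z}^n=\{\mathbf{m}_0,\ldots,\mathbf{m}_\ell\}$, let $\{\Delta_1,\Delta_2\}$ be a semi-stable partition of $\Delta$ in two subpolytopes with $X_{\Delta_1},X_{\Delta_2}$ smooth, and let $F$ be the associated lifting function. Then, as ideals of $\mathbb{C}[x_0,\ldots,x_\ell,\eta]$, $$I_F=\langle\, \mathbf{z}^{\mathbf{u}^+}-\mathbf{z}^{\mathbf{u}^-}\ \mid\ \mathbf{u}\in\ker(\mathcal{B}^+)\text{ and }\mathbf{u}\in\mathbb{Z}^{\ell+2}\,\rangle .$$
   Context: Polytopes. The lattice is $M=\mathbb{Z}^n\subset\mathbb{R}^n$. $\Delta\subset\mathbb{R}^n$ is a compact convex $n$-dimensional lattice polytope whose toric variety $X_\Delta$ (given by its normal fan) is smooth. Its lattice points are $\Delta\cap\mathbb{Z}^n=\{\mathbf{m}_0,\ldots,\mathbf{m}_\ell\}$, with $\mathbf{m}_j=(m_{1j},\ldots,m_{nj})$. Partition. $\Gamma=\{\Delta_1,\Delta_2\}$ is a partition (polyhedral subdivision) of $\Delta$ in two $n$-dimensional lattice subpolytopes such that the toric varieties $X_{\Delta_1}$, $X_{\Delta_2}$ are smooth. Faces are understood to be relatively open. An $l$-face of $\Gamma$ is an open $l$-dimensional face of some $\Delta_j$, with the convention that the $0$-faces of $\Delta$ are not $0$-faces of $\Gamma$. $\Gamma$ is semi-stable if for any $l$-face $\sigma$ of $\Gamma$, if $\theta$ is the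 $k$-face of $\Delta$ such that $\sigma\subset\theta$, then there are exactly $k-l+1$ of the $\Delta_j$'s such that $\sigma$ is a face of each of them. Lifting function. Let $a_1y_1+\cdots+a_ny_n+a_{n+1}=0$, with $a_1,\ldots,a_{n+1}\in\mathbb{Z}$, be an equation of the hyperplane containing the cut $\Delta_1\cap\Delta_2$, with signs chosen so that $a_1m_{1j}+\cdots+a_nm_{nj}+a_{n+1}\ge 0$ for all $\mathbf{m}_j\in\Delta_2\cap\mathbb{Z}^n$. Then $$F(\mathbf{m}_j)=\begin{cases}0 & \mathbf{m}_j\in\Delta_1\\ a_1m_{1j}+\cdots+a_nm_{nj}+a_{n+1} & \mathbf{m}_j\in\Delta_2.\end{cases}$$ Variety. $\tilde X_F\subset\mathbb{P}^\ell\times\mathbb{C}$ is the Zariski closure of the image of $$\psi_F:(\mathbb{C}^* )^n\times\mathbb{C}\to\mathbb{P}^\ell\times\mathbb{C},\qquad (\mathbf{t},\lambda)\mapsto([\lambda^{F(\mathbf{m}_0)}\mathbf{t}^{\mathbf{m}_0},\ldots,\lambda^{F(\mathbf{m}_\ell)}\mathbf{t}^{\mathbf{m}_\ell}],\lambda),$$ where $\mathbf{t}^{\mathbf{u}}=t_1^{u_1}\cdots t_n^{u_n}$ and $\lambda^0=1$ (also for $\lambda=0$). Ideal. Let $x_0,\ldots,x_\ell$ be homogeneous coordinates on $\mathbb{P}^\ell$ and $\eta$ the coordinate on $\mathbb{C}$. $I_F\subset\mathbb{C}[x_0,\ldots,x_\ell,\eta]$ is the ideal generated by all polynomials that are homogeneous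 in $x_0,\ldots,x_\ell$ and vanish on $\tilde X_F$. Notation. $\mathbb{N}$ contains $0$. For $\mathbf{u}=(u_0,\ldots,u_\ell,u_{\ell+1})\in\mathbb{N}^{\ell+2}$, $\mathbf{z}^{\mathbf{u}}=x_0^{u_0}\cdots x_\ell^{u_\ell}\eta^{u_{\ell+1}}$. Each $\mathbf{u}\in\mathbb{Z}^{\ell+2}$ is written uniquely as $\mathbf{u}=\mathbf{u}^+-\mathbf{u}^-$ with $\mathbf{u}^+,\mathbf{u}^-\in\mathbb{N}^{\ell+2}$ having no non-zero components in common. $\langle\cdot\rangle$ denotes the ideal generated. $\mathcal{B}^+$ is the $(n+2)\times(\ell+2)$ integer matrix $$\mathcal{B}^+=\begin{pmatrix}1&1&\cdots&1&0\\ m_{10}&m_{11}&\cdots&m_{1\ell}&0\\ \vdots&\vdots&&\vdots&\vdots\\ m_{n0}&m_{n1}&\cdots&m_{n\ell}&0\\ F(\mathbf{m}_0)&F(\mathbf{m}_1)&\cdots&F(\mathbf{m}_\ell)&1\end{pmatrix}.$$ *)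

(* Defs.v *)
From HB Require Import structures.
From mathcomp Require Import all_boot all_order all_algebra.
From mathcomp Require Import boolp classical_sets reals.
From mathcomp Require Import complex mpoly.

Set Implicit Arguments.
Unset Strict Implicit.
Unset Printing Implicit Defensive.

Import Order.TTheory GRing.Theory Num.Theory.

Local Open Scope classical_set_scope.
Local Open Scope ring_scope.

Definition dotv (K : pzRingType) (n : nat) (u x : 'rV[K]_n) : K :=
  \sum_(i < n) u 0 i * x 0 i.

Section Polytopes.
Variables (R : realType) (n : nat).
Implicit Types (A P Q s : set 'rV[R]_n) (G : seq (set 'rV[R]_n)).

Definition of_lattice (p : 'rV[int]_n) : 'rV[R]_n := map_mx intr p.

Definition convex_hull A : set 'rV[R]_n :=
  [set x | exists (k : nat) (p : 'I_k -> 'rV[R]_n) (w : 'I_k -> R),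
     [/\ forall i, A (p i), forall i, 0 <= w i, \sum_i w i = 1
       & x = \sum_i w i *: p i]].

Definition affine_hull A : set 'rV[R]_n :=
  [set x | exists (k : nat) (p : 'I_k -> 'rV[R]_n) (w : 'I_k -> R),
     [/\ forall i, A (p i), \sum_i w i = 1 & x = \sum_i w i *: p i]].

(* The affine hull of A is a translate of the row space of a rank d matrix;
   the empty set has no dimension. *)
Definition has_dim A (d : nat) : Prop :=
  exists (x0 : 'rV[R]_n) (B : 'M[R]_(d, n)),
    [/\ A x0, row_free B & affine_hull A = [set x | (x - x0 <= B)%MS]].

(* Interior relative to the affine hull, for the sup-norm topology. *)
Definition relint A : set 'rV[R]_n :=
  [set x | A x /\ exists2 e : R, 0 < e &
     forall y, affine_hull A y -> (forall i, `|y 0 i - x 0 i| < e) -> A y].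

Definition lattice_polytope P : Prop :=
  exists2 V : seq 'rV[int]_n, V != [::] &
    P = convex_hull [set of_lattice v | v in [set` V]].

(* Nonempty closed faces; u = 0 gives P itself. *)
Definition closed_face P Q : Prop :=
  Q !=set0 /\
  exists u, Q = [set x | P x /\ forall y, P y -> dotv u x <= dotv u y].

Definition open_face P s : Prop := exists2 Q, closed_face P Q & s = relint Q.

Definition open_face_dim P (d : nat) s : Prop := open_face P s /\ has_dim s d.

(* The cone of the (inner) normal fan of P attached to the face Q. *)
Definition normal_cone P Q : set 'rV[R]_n :=
  [set u | forall x y, Q x -> P y -> dotv u x <= dotv u y].

(* The semigroup of the lattice points of the dual cone of C. *)
Definition dual_semigroup (C : set 'rV[R]_n) : set 'rV[int]_n :=
  [set m | forall u, C u -> 0 <= dotv u (of_lattice m)].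

(* Closed points of the affine toric variety Spec CC[S]: the CC-algebra
   morphisms CC[S] -> CC, that is, the monoid morphisms from S to the
   multiplicative monoid CC. Only the values on S are relevant. *)
Definition toric_point (S : set 'rV[int]_n) (p : 'rV[int]_n -> R[i]) : Prop :=
  p 0 = 1 /\ forall m m', S m -> S m' -> p (m + m') = p m * p m'.

(* Zariski tangent vectors of Spec CC[S] at p: the CC-linear derivations
   CC[S] -> CC at p, given by their values on the basis S of CC[S]. *)
Definition toric_tangent (S : set 'rV[int]_n) (p d : 'rV[int]_n -> R[i])
    : Prop :=
  forall m m', S m -> S m' -> d (m + m') = p m * d m' + p m' * d m.

(* Every Zariski tangent space of Spec CC[S] has dimension n. *)
Definition smooth_affine_toric (S : set 'rV[int]_n) : Prop :=
  forall p, toric_point S p ->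
    exists b : 'I_n -> 'rV[int]_n -> R[i],
      (forall i, toric_tangent S p (b i)) /\
      (forall d, toric_tangent S p d ->
         exists! c : 'rV[R[i]]_n, forall m, S m -> d m = \sum_i c 0 i * b i m).

(* Smoothness of the n-dimensional toric variety of the normal fan of P,
   checked on the affine charts Spec CC[C^dual /\ M], one for each cone C of
   the fan, by which it is covered. *)
Definition smooth_toric_variety P : Prop :=
  forall Q, closed_face P Q ->
    smooth_affine_toric (dual_semigroup (normal_cone P Q)).

Definition smooth_lattice_polytope P : Prop :=
  [/\ lattice_polytope P, has_dim P n & smooth_toric_variety P].

Definition polyhedral_subdivision P G : Prop :=
  [/\ uniq G,
      P = [set x | exists2 Q, Q \in G & Q x]
    & forall Q Q', Q \in G -> Q' \in G -> Q `&` Q' !=set0 ->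
        closed_face Q (Q `&` Q') /\ closed_face Q' (Q `&` Q')].

Definition subdivision_face P G (l : nat) s : Prop :=
  (exists2 Q, Q \in G & open_face_dim Q l s) /\
  ~ (l = 0%N /\ open_face_dim P 0 s).

(* The condition k.+1 = l + c says that the number c of pieces is k - l + 1. *)
Definition semistable P G : Prop :=
  forall l s, subdivision_face P G l s ->
  forall k t, open_face_dim P k t -> s `<=` t ->
    k.+1 = (l + count (fun Q => `[< open_face Q s >]) G)%N.

(* a.y + b = 0 is an equation of a hyperplane containing the cut of P1 and
   P2, nonnegative on the lattice points of P2. *)
Definition cut_equation P1 P2 (a : 'rV[int]_n) (b : int) : Prop :=
  [/\ a != 0,
      forall y, P1 y -> P2 y -> dotv (of_lattice a) y + b%:~R = 0
    & forall p, P2 (of_lattice p) -> 0 <= dotv a p + b].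

Definition lifting P1 (a : 'rV[int]_n) (b : int) (p : 'rV[int]_n) : int :=
  if `[< P1 (of_lattice p) >] then 0 else dotv a p + b.

End Polytopes.

Section Ideals.

Definition ideal_gen (A : comNzRingType) (S : set A) : set A :=
  [set f | exists (k : nat) (c g : 'I_k -> A),
     (forall i, S (g i)) /\ f = \sum_i c i * g i].

Variables (R : realType) (l : nat).

(* CC[x_0, ..., x_l, eta]: the first l + 1 variables are the x_j, the last
   one is eta. *)
Local Notation poly := {mpoly R[i][l.+1 + 1]}.

Definition x_homogeneous (f : poly) : Prop :=
  exists d : nat, forall u, u \in msupp f ->
    (\sum_(j < l.+1) u (lshift 1 j))%N = d.

(* PP^l x CC, a point of PP^l being a line through 0 in CC^(l+1). *)
Local Notation point := ({vspace 'rV[R[i]]_l.+1} * R[i])%type.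

Definition proj_aff : set point := [set z | \dim z.1 = 1%N].

(* For f homogeneous in x, vanishing does not depend on the choice of the
   homogeneous coordinates x of z.1. *)
Definition vanishes_at (f : poly) (z : point) : Prop :=
  forall x : 'rV[R[i]]_l.+1, x \in z.1 -> x != 0 ->
    f.@[fun i => row_mx x (const_mx z.2) 0 i] = 0.

Definition zariski_closed (Z : set point) : Prop :=
  exists2 S : set poly, (forall f, S f -> x_homogeneous f) &
    Z = [set z | proj_aff z /\ forall f, S f -> vanishes_at f z].

Definition zariski_closure (A : set point) : set point :=
  smallest zariski_closed A.

Definition homogeneous_ideal (X : set point) : set poly :=
  ideal_gen [set f | x_homogeneous f /\ forall z, X z -> vanishes_at f z].

Definition zmonom_pos (u : 'cV[int]_(l.+1 + 1)) : poly :=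
  'X_[[multinom absz (Num.max (u i 0) 0)%R | i < l.+1 + 1]].

Definition zmonom_neg (u : 'cV[int]_(l.+1 + 1)) : poly :=
  'X_[[multinom absz (Num.max (- u i 0) 0)%R | i < l.+1 + 1]].

Section Degeneration.
Variables (n : nat) (m : 'I_l.+1 -> 'rV[int]_n) (F : 'I_l.+1 -> int).

(* Integer powers; 0 ^ 0 = 1. *)
Definition psi (t : 'rV[R[i]]_n) (lam : R[i]) : point :=
  (<[\row_j (lam ^ F j * \prod_(i < n) t 0 i ^ m j 0 i)]>%VS, lam).

Definition variety_F : set point :=
  zariski_closure
    [set z | exists (t : 'rV[R[i]]_n) (lam : R[i]),
       (forall i, t 0 i != 0) /\ z = psi t lam].

Definition ideal_F : set poly := homogeneous_ideal variety_F.

Definition Bplus : 'M[int]_((1 + n) + 1, l.+1 + 1) :=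
  block_mx (col_mx (const_mx 1) (\matrix_(i, j) m j 0 i)) 0
           (\row_j F j)                                  1%:M.

End Degeneration.
End Ideals.

Arguments zmonom_pos R {l} u.
Arguments zmonom_neg R {l} u.
Arguments psi {R l n} m F t lam.
Arguments variety_F R {l n} m F.
Arguments ideal_F R {l n} m F.

(* Main.v *)
Require Import Defs.
From mathcomp Require Import all_boot all_order all_algebra.
From mathcomp Require Import boolp classical_sets reals.
From mathcomp Require Import complex mpoly.
From mathcomp Require Import zify.
Import GRing.Theory Num.Theory.
Local Open Scope classical_set_scope.
Local Open Scope ring_scope.

(** The proof shows that every toric ideal is generated by its binomials and
    identifies ideal_F with a toric ideal.

    Let K be the field of complex numbers, and let an integer matrix B with N
    rows send t in the torus (K^* )^N to the point whose k-th coordinate is the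
    character of t with exponents the k-th column of B. A monomial with
    exponent vector p takes at this point the value of the character with
    exponents B p (meval_torus). If f vanishes on the image of the torus, the
    linear independence of distinct characters shows that, for each weight w,
    the coefficients of f on the monomials p with B p = w add up to 0. So f
    does not change when, for each of its weights, one subtracts from its
    monomials one chosen monomial of the same weight: f is a combination of
    differences of two monomials of equal weight, and such a difference is a
    monomial times a binomial z^(u+) - z^(u-) with B u = 0 (toric_ideal).

    For B = Bplus, the first coordinate of the torus is the scaling of the
    homogeneous coordinates and the last one is lambda, so the torus maps to
    the homogeneous coordinate vectors of the points psi t lambda with lambda
    nonzero (torus_char_Bplus). Hence every x-homogeneous polynomial that
    vanishes on the variety lies in the toric ideal. Conversely, the first row
    of Bplus makes the binomials homogeneous in x, and they vanish on the
    whole image of psi, including lambda = 0, because no exponent of lambda is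
    negative; being homogeneous, they vanish on the closure too.

    What the geometry of the subdivision provides is that F is nonnegative, by
    the sign chosen for the equation of the cut, and that F takes the value 0,
    at a vertex of Delta1, which makes the coordinate vector of psi t 0
    nonzero. *)

(** * Linear independence of characters *)

Lemma big_fibers (V : nmodType) (T W : eqType) (s : seq T) (p : T -> W)
    (G : T -> V) :
  \sum_(u <- s) G u =
  \sum_(w <- undup [seq p u | u <- s]) \sum_(u <- s | p u == w) G u.
Proof.
under [RHS]eq_bigr do rewrite big_mkcond.
rewrite exchange_big; apply: eq_big_seq => u us /=.
rewrite (bigD1_seq (p u)) ?undup_uniq ?mem_undup ?map_f //=.
by rewrite eqxx big1 ?addr0 // => w; rewrite eq_sym => /negPf ->.
Qed.

Section Characters.
Variables (K : idomainType) (G : Type) (D : G -> Prop).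
Variables (one : G) (mul : G -> G -> G).

(** Artin's argument: if [chi i h != chi i0 h], then scaling a relation by
    [chi i0 h] and subtracting it from its translate by [h] eliminates [i0]
    and multiplies [c i] by the nonzero factor [chi i h - chi i0 h]. *)
Lemma characters_independent (I : eqType) (chi : I -> G -> K) (s : seq I)
    (c : I -> K) :
    D one -> (forall g h, D g -> D h -> D (mul g h)) ->
    (forall i, chi i one = 1) ->
    (forall i g h, D g -> D h -> chi i (mul g h) = chi i g * chi i h) ->
    (forall i j, i != j -> exists2 g, D g & chi i g != chi j g) ->
    uniq s -> (forall g, D g -> \sum_(i <- s) c i * chi i g = 0) ->
  {in s, forall i, c i = 0}.
Proof.
move=> D1 DM chi1 chiM chi_sep.
elim: s c => [//|i0 s IHs] c /= /andP[i0s us] c0.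
have cs0 : {in s, forall i, c i = 0}.
  move=> i si; have ii0 : i != i0 by apply: contraNneq i0s => <-.
  have [h Dh chi_h] := chi_sep _ _ ii0.
  have := IHs (fun i => c i * (chi i h - chi i0 h)) us _ i si.
  move=> /(_ _)/eqP; rewrite mulf_eq0 subr_eq0 (negPf chi_h) orbF.
  move=> /(_ _)/eqP; apply=> g Dg.
  have := c0 _ (DM _ _ Dh Dg).
  have := congr1 ( *%R (chi i0 h)) (c0 _ Dg).
  rewrite mulr0 !big_cons mulrDr chiM // => e1 e2.
  have := congr2 (fun x y => y - x) e1 e2.
  rewrite subr0 [chi i0 h * (c i0 * _)]mulrCA opprD addrACA subrr add0r.
  rewrite mulr_sumr -sumrB => e.
  rewrite -[RHS]e; apply: eq_bigr => j _.
  by rewrite chiM // mulrBr mulrBl !mulrA [chi i0 h * _]mulrC.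
move=> i; rewrite inE => /predU1P[->|]; last exact: cs0.
have := c0 _ D1; rewrite big_cons chi1 mulr1 big_seq big1 ?addr0 // => j js.
by rewrite cs0 // mul0r.
Qed.

End Characters.

(** * Monomials as characters of a torus *)

Section Torus.
Variables (K : numFieldType) (N : nat).
Implicit Types (w : 'cV[int]_N) (t : 'rV[K]_N).

Definition torus_char w t : K := \prod_i t 0 i ^ w i 0.

(** [wt] need not be injective, so independence of the characters only kills
    the sum of the coefficients over each of its fibers. *)
Lemma torus_chars_independent (T : eqType) (wt : T -> 'cV[int]_N) (s : seq T)
    (c : T -> K) :
    (forall t, (forall i, t 0 i != 0) ->
       \sum_(u <- s) c u * torus_char (wt u) t = 0) ->
  {in s, forall v, \sum_(u <- s | wt u == wt v) c u = 0}.
Proof.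
move=> c0 v vs.
pose cw w := \sum_(u <- s | wt u == w) c u.
apply: (@characters_independent K _ (fun t => forall i, t 0 i != 0)
  (const_mx 1) (fun t t' => \row_i (t 0 i * t' 0 i)) _ torus_char
  (undup [seq wt u | u <- s]) cw).
- by move=> i; rewrite mxE oner_eq0.
- by move=> g h g0 h0 i; rewrite mxE mulf_neq0.
- by move=> w; rewrite /torus_char big1 // => i _; rewrite mxE exp1rz.
- move=> w g h g0 h0; rewrite /torus_char -big_split; apply: eq_bigr => i _.
  by rewrite mxE exprzMl ?unitfE.
- move=> w w' ww'.
  have [i wi] : exists i, (w - w') i 0 != 0 by apply/cV0Pn; rewrite subr_eq0.
  move: wi; rewrite !mxE subr_eq0 => wi.
  (* 2 is not a root of unity, so it tells apart the exponents w i and w' i. *)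
  exists (\row_k (if k == i then 2 else 1)).
    by move=> k; rewrite mxE; case: ifP => _; rewrite ?pnatr_eq0 ?oner_eq0.
  rewrite /torus_char !(bigD1 (P := xpredT) i) //= !mxE eqxx.
  rewrite !big1 ?mulr1; first last.
  - by move=> k /negPf ki; rewrite mxE ki exp1rz.
  - by move=> k /negPf ki; rewrite mxE ki exp1rz.
  apply: contraNneq wi => /eqP e; rewrite -subr_eq0.
  have two0 : (2 : K) != 0 by rewrite pnatr_eq0.
  have : (2 : K) ^ (w i 0 - w' i 0) == 1.
    by rewrite expfzDr // (eqP e) -expfzDr // subrr.
  by rewrite pexprz_eq1 ?ler0n // (eqr_nat K 2 1) orbF.
- exact: undup_uniq.
- move=> t t0; rewrite -[RHS](c0 t t0) [RHS](big_fibers _ _ _ _ wt).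
  apply: eq_bigr => w _; rewrite mulr_suml.
  by apply: eq_bigr => u /eqP ->.
- by rewrite mem_undup map_f.
Qed.

(** For [x = 0] the addition of exponents fails in general, but it survives for
    nonnegative ones; this is what allows lambda = 0 further on. *)
Lemma prodr_exprz (k : nat) (x : K) (a : 'I_k -> int) (p : 'I_k -> nat) :
    x != 0 \/ (forall j, 0 <= a j) ->
  \prod_j (x ^ a j) ^+ p j = x ^ (\sum_j a j * p j).
Proof.
case=> [x0|a0].
  elim/big_rec2: _ => [|j y z _ ->]; first by rewrite expr0z.
  by rewrite expfzDr // exprnP exprz_exp.
suff [] : 0 <= \sum_j a j * p j /\
  \prod_j (x ^ a j) ^+ p j = x ^ (\sum_j a j * p j) by [].
elim/big_rec2: _ => [|j y z _ [y0 ->]]; first by rewrite expr0z.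
have ap0 : 0 <= a j * p j by rewrite mulr_ge0.
by rewrite exprzD_ss ?ap0 ?y0 // exprnP exprz_exp addr_ge0.
Qed.

(** The map from the torus given by the columns of [B] turns the monomial with
    exponent vector [p] into the character with exponents [B p]. *)
Lemma meval_torus (k : nat) (B : 'M[int]_(N, k)) (p : 'X_{1.. k}) t :
    (forall i, t 0 i != 0 \/ forall j, 0 <= B i j) ->
  'X_[K, p].@[fun j => torus_char (col j B) t] =
  torus_char (B *m \col_j (p j)%:Z) t.
Proof.
move=> tB; rewrite mevalX /torus_char.
transitivity (\prod_j \prod_i (t 0 i ^ B i j) ^+ p j).
  apply: eq_bigr => j _; rewrite prodrXl; congr (_ ^+ _).
  by apply: eq_bigr => i _; rewrite mxE.
rewrite exchange_big; apply: eq_bigr => i _.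
by rewrite prodr_exprz // mxE; congr (_ ^ _); apply: eq_bigr => j _; rewrite mxE.
Qed.

End Torus.

Arguments torus_char {K N} w t.

(** * Ideals given by generators *)

Section IdealGen.
Variables (A : comNzRingType) (S : set A).

Lemma ideal_gen0 : ideal_gen S 0.
Proof. by exists 0%N, (fun=> 0), (fun=> 0); split=> [[]|]; rewrite ?big_ord0. Qed.

Lemma ideal_genD f g : ideal_gen S f -> ideal_gen S g -> ideal_gen S (f + g).
Proof.
move=> [k [c [s [Ss ->]]]] [k' [c' [s' [Ss' ->]]]].
exists (k + k')%N, (fun i => match split i with inl j => c j | inr j => c' j end),
  (fun i => match split i with inl j => s j | inr j => s' j end).
split=> [i|]; first by case: split.
rewrite big_split_ord; congr (_ + _); apply: eq_bigr => i _.
  by rewrite (unsplitK (inl i)).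
by rewrite (unsplitK (inr i)).
Qed.

Lemma ideal_genMl h f : ideal_gen S f -> ideal_gen S (h * f).
Proof.
move=> [k [c [s [Ss ->]]]]; exists k, (fun i => h * c i), s; split=> //.
by rewrite mulr_sumr; apply: eq_bigr => i _; rewrite mulrA.
Qed.

Lemma sub_ideal_gen : S `<=` ideal_gen S.
Proof.
move=> f Sf; exists 1%N, (fun=> 1), (fun=> f); split=> //.
by rewrite big_ord1 mul1r.
Qed.

Lemma ideal_gen_sum (T : Type) (s : seq T) (P : pred T) (F : T -> A) :
    (forall i, P i -> ideal_gen S (F i)) -> ideal_gen S (\sum_(i <- s | P i) F i).
Proof. by move=> SF; apply: big_ind => //; [exact: ideal_gen0|exact: ideal_genD]. Qed.

End IdealGen.

Lemma ideal_gen_sub (A : comNzRingType) (S T : set A) :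
  S `<=` ideal_gen T -> ideal_gen S `<=` ideal_gen T.
Proof.
move=> ST f [k [c [s [Ss ->]]]].
by apply: ideal_gen_sum => i _; apply: ideal_genMl; apply: ST.
Qed.

(** * Toric ideals are generated by binomials *)

Section ToricIdeal.
Variables (R : realType) (l N : nat) (B : 'M[int]_(N, l.+1 + 1)).

Definition toric_binomials : set {mpoly R[i][l.+1 + 1]} :=
  [set f | exists2 u : 'cV[int]_(l.+1 + 1),
     B *m u = 0 & f = zmonom_pos R u - zmonom_neg R u].

Definition weight (p : 'X_{1.. l.+1 + 1}) : 'cV[int]_N :=
  B *m \col_j (p j)%:Z.

Lemma absz_max0_sub (x : int) :
  ((absz (Num.max x 0))%:Z - (absz (Num.max (- x) 0))%:Z = x)%R.
Proof.
by lia.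
Qed.

Lemma weight_pos_neg (u : 'cV[int]_(l.+1 + 1)) : B *m u = 0 ->
  weight [multinom absz (Num.max (u i 0) 0)%R | i < l.+1 + 1] =
  weight [multinom absz (Num.max (- u i 0) 0)%R | i < l.+1 + 1].
Proof.
move=> Bu; apply/eqP; rewrite -subr_eq0 -mulmxBr; apply/eqP; rewrite -[RHS]Bu.
by congr (_ *m _); apply/matrixP => i j; rewrite !mxE !mnmE absz_max0_sub ord1.
Qed.

(** Dividing both monomials by their greatest common divisor leaves
    [z^(u+) - z^(u-)] for the difference [u] of the exponent vectors. *)
Lemma monomial_sub_ideal (p q : 'X_{1.. l.+1 + 1}) :
  weight p = weight q -> ideal_gen toric_binomials ('X_[p] - 'X_[q]).
Proof.
move=> wpq; pose u : 'cV[int]_(l.+1 + 1) := \col_j (p j)%:Z - \col_j (q j)%:Z.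
pose r := [multinom minn (p i) (q i) | i < l.+1 + 1].
have -> : 'X_[p] = 'X_[r] * zmonom_pos R u.
  rewrite -mpolyXD; congr 'X_[_]; apply/mnmP => i; rewrite mnmDE !mnmE !mxE.
  by lia.
have -> : 'X_[q] = 'X_[r] * zmonom_neg R u.
  rewrite -mpolyXD; congr 'X_[_]; apply/mnmP => i; rewrite mnmDE !mnmE !mxE.
  by lia.
rewrite -mulrBr; apply/ideal_genMl/sub_ideal_gen; exists u => //.
by rewrite mulmxBr [X in X - _]wpq subrr.
Qed.

(** For each weight, all monomials of [f] of that weight are compared to the
    single monomial [rep] of the same weight; the coefficients of [f] that are
    collected at that monomial cancel out. *)
Lemma toric_ideal (f : {mpoly R[i][l.+1 + 1]}) :
    (forall t : 'rV[R[i]]_N, (forall i, t 0 i != 0) ->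
       f.@[fun j => torus_char (col j B) t] = 0) ->
  ideal_gen toric_binomials f.
Proof.
move=> f0.
have coef0 : {in msupp f, forall v,
    \sum_(u <- msupp f | weight u == weight v) f@_u = 0}.
  apply: torus_chars_independent => t t0; rewrite -[RHS](f0 t t0).
  rewrite {3}(mpolyE f) linear_sum /=; apply: eq_bigr => u _.
  by rewrite linearZ /= meval_torus // => i; left.
pose rep w := head 0%MM [seq u <- msupp f | weight u == w].
have weight_rep : {in msupp f, forall u, weight (rep (weight u)) = weight u}.
  move=> u uf.
  have : rep (weight u) \in [seq v <- msupp f | weight v == weight u].
    have : u \in [seq v <- msupp f | weight v == weight u].
      by rewrite mem_filter eqxx.
    by rewrite /rep; case: filter => //= v s _; rewrite mem_head.
  by rewrite mem_filter => /andP[/eqP].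
have rep0 : \sum_(u <- msupp f) f@_u *: 'X_[R[i], rep (weight u)] = 0.
  rewrite (big_fibers _ _ _ _ weight) big_seq big1 // => w.
  rewrite mem_undup => /mapP[v vf ->].
  rewrite (eq_bigr (fun u => f@_u *: 'X_[rep (weight v)])) => [|u /eqP -> //].
  by rewrite -scaler_suml coef0 // scale0r.
rewrite (mpolyE f) -[X in ideal_gen _ X]subr0 -[X in _ - X]rep0 -sumrB big_seq.
apply: ideal_gen_sum => u uf; rewrite -scalerBr -mul_mpolyC.
by apply/ideal_genMl/monomial_sub_ideal; rewrite weight_rep.
Qed.

End ToricIdeal.

Arguments weight {l N} B p.

(** * The ideal of the degeneration *)

Section Degeneration.
Variables (R : realType) (l n : nat).
Variables (m : 'I_l.+1 -> 'rV[int]_n) (F : 'I_l.+1 -> int).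

(** Any homogeneous coordinate vector of [psi t lam] is the image of
    [(c, t, lam)] for a nonzero scaling factor [c]; [c] pairs with the row of
    ones of [Bplus] and [lam] with its last row. *)
Lemma torus_char_Bplus (c lam : R[i]) (t : 'rV[R[i]]_n) :
  (fun k => row_mx (c *: \row_j (lam ^ F j * \prod_(i < n) t 0 i ^ m j 0 i))
              (const_mx lam) 0 k) =
  (fun k => torus_char (col k (Bplus m F))
              (row_mx (row_mx (const_mx c) t) (const_mx lam))).
Proof.
apply/funext => k; rewrite /torus_char !big_split_ord !big_ord1 /=.
have colE i : col k (Bplus m F) i 0 = Bplus m F i k by rewrite mxE.
under [in RHS]eq_bigr do rewrite row_mxEl row_mxEr colE.
rewrite !colE [row_mx (row_mx _ _) _ _ _]row_mxEl row_mxEl.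
rewrite [row_mx (row_mx _ _) _ _ _]row_mxEr.
rewrite [const_mx c _ _]mxE [const_mx lam _ _ in RHS]mxE.
have [j ->|j ->] := split_ordP k.
  rewrite row_mxEl block_mxEul block_mxEdl col_mxEu !mxE expr1z -[RHS]mulrA.
  congr (_ * _); rewrite mulrC; congr (_ * _).
  by apply: eq_bigr => i _; rewrite block_mxEul col_mxEd mxE.
rewrite row_mxEr block_mxEur block_mxEdr !mxE !ord1 eqxx expr0z mul1r.
by rewrite big1 ?mul1r ?expr1z // => i _; rewrite block_mxEur mxE expr0z.
Qed.

Lemma vanishes_psi (f : {mpoly R[i][l.+1 + 1]}) (t : 'rV[R[i]]_n) (lam : R[i]) :
  vanishes_at f (psi m F t lam) <->
  forall c, c *: \row_j (lam ^ F j * \prod_(i < n) t 0 i ^ m j 0 i) != 0 ->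
    f.@[fun k => torus_char (col k (Bplus m F))
              (row_mx (row_mx (const_mx c) t) (const_mx lam))] = 0.
Proof.
split=> [f0 c c0|f0 x /vlineP[c ->] c0]; last by rewrite torus_char_Bplus f0.
by rewrite -torus_char_Bplus; apply: f0 => //; apply/vlineP; exists c.
Qed.

(** The first entry of the weight of a monomial is its degree in x. *)
Lemma x_homogeneous_binomial (p q : 'X_{1.. l.+1 + 1}) :
  weight (Bplus m F) p = weight (Bplus m F) q ->
  x_homogeneous ('X_[p] - 'X_[q] : {mpoly R[i][l.+1 + 1]}).
Proof.
have degE (r : 'X_{1.. l.+1 + 1}) :
    weight (Bplus m F) r (lshift 1 (lshift n 0)) 0
    = (\sum_(j < l.+1) r (lshift 1 j))%N.
  rewrite mxE big_split_ord big_ord1 /= block_mxEur !mxE mul0r addr0.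
  rewrite -natz natr_sum; apply: eq_bigr => j _.
  by rewrite block_mxEul col_mxEu !mxE mul1r natz.
move=> /(congr1 (fun w : 'cV_(1 + n + 1) => w (lshift 1 (lshift n 0)) 0)).
rewrite !degE => -[pq]; exists (\sum_(j < l.+1) p (lshift 1 j))%N => u.
move=> /msuppB_le; rewrite mem_cat !msuppX !inE => /orP[]/eqP -> //.
Qed.

(** Nonnegativity of [F] extends the vanishing of the binomials to [lam = 0].
    The value 0 of [F] guarantees that [psi t 0] is a point of the projective
    space: no closed set contains a point without nonzero coordinates, so
    the closure of the image would otherwise degenerate. *)
Lemma degeneration_ideal :
    (forall j, 0 <= F j) -> (exists j, F j = 0) ->
  ideal_F R m F = ideal_gen (toric_binomials R _ _ (Bplus m F)).
Proof.
move=> F0 [j0 Fj0].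
have row0 (t : 'rV[R[i]]_n) (lam : R[i]) : (forall i, t 0 i != 0) ->
    \row_j (lam ^ F j * \prod_(i < n) t 0 i ^ m j 0 i) != 0.
  move=> t0; apply/rV0Pn; exists j0; rewrite mxE Fj0 expr0z mul1r.
  by apply/prodf_neq0 => i _; rewrite expfz_neq0.
apply/seteqP; split.
  apply: ideal_gen_sub => f [_ f0]; apply: toric_ideal => t t0.
  pose s : 'rV_n := rsubmx (lsubmx t).
  pose c := lsubmx (lsubmx t) 0 0; pose lam := rsubmx t 0 0.
  have s0 i : s 0 i != 0 by rewrite !mxE.
  have c0 : c != 0 by rewrite /c !mxE.
  have -> : t = row_mx (row_mx (const_mx c) s) (const_mx lam).
    have const11 (x : 'M[R[i]]_1) : const_mx (x 0 0) = x.
      by apply/matrixP => i j; rewrite mxE !ord1.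
    by rewrite !const11 !hsubmxK.
  have /vanishes_psi : vanishes_at f (psi m F s lam).
    by apply: f0; apply: sub_gen_smallest; exists s, lam.
  by apply; rewrite scaler_eq0 negb_or c0 row0.
apply: ideal_gen_sub => _ [u Bu ->]; apply: sub_ideal_gen.
have wu := weight_pos_neg _ _ _ u Bu.
have hom := x_homogeneous_binomial _ _ wu.
split=> // z; pose S := [set zmonom_pos R u - zmonom_neg R u].
(* The zero set of the binomial is closed, so it is enough to contain the
   image of psi. *)
suff sub : variety_F R m F `<=`
  [set z | proj_aff z /\ forall f, S f -> vanishes_at f z].
  by move=> /sub[_]; apply.
apply: smallest_sub; first by exists S => // f ->.
move=> _ [t [lam [t0 ->]]]; split; first by rewrite /proj_aff /= dim_vline row0.
move=> f ->; apply/vanishes_psi => c; rewrite scaler_eq0 negb_or => /andP[c0 _].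
set s := row_mx _ _.
(* Only the last coordinate lam of s can vanish, and it pairs with the row of
   Bplus formed by the entries of F and 1. *)
have sB i : s 0 i != 0 \/ forall j, 0 <= Bplus m F i j.
  case: (split_ordP i) => [i' ->|i' ->].
    by left; rewrite row_mxEl; case: (split_ordP i') => k ->;
      rewrite ?row_mxEl ?row_mxEr ?mxE.
  right=> j; case: (split_ordP j) => k ->; first by rewrite block_mxEdl mxE.
  by rewrite block_mxEdr !ord1 mxE.
by rewrite mevalB !meval_torus // [X in torus_char X]wu subrr.
Qed.
End Degeneration.

Theorem theorem3p2 (R : realType) (n l : nat)
  (Delta Delta1 Delta2 : set 'rV[R]_n)
  (m : 'I_l.+1 -> 'rV[int]_n) (a : 'rV[int]_n) (b : int)
  (hDelta : smooth_lattice_polytope Delta)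
  (m_inj : injective m)
  (m_pts : forall p : 'rV[int]_n,
     Delta (of_lattice R p) <-> exists j, m j = p)
  (hDelta1 : smooth_lattice_polytope Delta1)
  (hDelta2 : smooth_lattice_polytope Delta2)
  (hGamma : polyhedral_subdivision Delta [:: Delta1; Delta2])
  (hss : semistable Delta [:: Delta1; Delta2])
  (hcut : cut_equation Delta1 Delta2 a b) :
  let F := fun j => lifting Delta1 a b (m j) in
  ideal_F R m F =
  ideal_gen [set f : {mpoly R[i][l.+1 + 1]} |
     exists2 u : 'cV[int]_(l.+1 + 1),
       Bplus m F *m u = 0 & f = zmonom_pos R u - zmonom_neg R u].
Proof.
move=> F.
case: hGamma => _ Delta_eq _; case: hcut => _ _ cut_ge0.
apply: degeneration_ideal => [j|].
  have : Delta (of_lattice R (m j)) by apply/m_pts; exists j.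
  rewrite /F /lifting Delta_eq; case: asboolP => // nD1 [Q].
  by rewrite !inE => /orP[]/eqP -> // D2; apply: cut_ge0.
have [[[//|v V] _ Delta1_eq] _ _] := hDelta1.
have D1v : Delta1 (of_lattice R v).
  rewrite Delta1_eq; exists 1%N, (fun=> of_lattice R v), (fun=> 1).
  split=> [_|_||]; rewrite ?big_ord1 ?scale1r ?ler01 //.
  by exists v; rewrite //= mem_head.
have [j mj] : exists j, m j = v.
  by apply/m_pts; rewrite Delta_eq; exists Delta1; rewrite ?mem_head.
by exists j; rewrite /F /lifting mj; case: asboolP.
Qed.
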